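(* Let $r\geq 2$ be an integer. If $\varepsilon\in\left[\frac{1}{r},\frac{1}{r-1/(r^2-1)}\right)$, then the upper bound $\mu(3;\varepsilon)\leq\left\lceil \frac 1\varepsilon\left\lceil \frac1\varepsilon\right\rceil\right\rceil\cdot \left\lceil \frac 1\varepsilon\right\rceil$ is tight, i.e. $\mu(3;\varepsilon)=r^3$.
   Context: For a positive integer $d$ and a real $\varepsilon\in(0,1)$, let $T^d=[\mathbb{R}/\mathbb{Z}]^d$ be the $d$-dimensional torus. An $\varepsilon$-sub-cube of $T^d$ is a set of the form $\{(x_1,\ldots,x_d): x_i\in[x_i^0,x_i^0+\varepsilon] \text{ for all } i\}$, where $x_1^0,\dots,x_d^0\in\mathbb{R}/\mathbb{Z}$ and $[x_i^0,x_i^0+\varepsilon]$ denotes the image in $\mathbb{R}/\mathbb{Z}$ of the corresponding closed real interval of length $\varepsilon$. $\mu(d;\varepsilon)$ denotes the minimum number of $\varepsilon$-sub-cubes whose union is $T^d$. *)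

(* Defs.v *)
From HB Require Import structures.
From mathcomp Require Import all_boot all_order all_algebra.
From mathcomp Require Import all_classical all_reals.

Set Implicit Arguments.
Unset Strict Implicit.
Unset Printing Implicit Defensive.

Import Order.TTheory GRing.Theory Num.Theory.
Import Quotient.

Local Open Scope classical_set_scope.
Local Open Scope ring_scope.
Local Open Scope quotient_scope.

(* The additive quotient group R/Z; int_num_subdef is the predicate behind the
   qualifier Num.int, and the one that carries the zmodClosed structure. *)
Definition circle (R : realType) := {quot (@Num.int_num_subdef R : {pred R})}.

Definition torus (R : realType) (d : nat) := 'rV[circle R]_d.

(* [x0, x0 + eps] in R/Z: the real interval starts at the representative of x0
   chosen by repr; arc_pi shows that the choice is immaterial. *)
Definition arc (R : realType) (eps : R) (x0 : circle R) : set (circle R) :=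
  [set \pi_(circle R) t | t in `[repr x0, repr x0 + eps]].

Lemma circle_eqP (R : realType) (x y : R) :
  reflect (exists k : int, x = y + k%:~R)
    (\pi_(circle R) x == \pi_(circle R) y).
Proof.
rewrite -idealrBE -[_ \in _]/(x - y \is a Num.int).
apply: (iffP (@intrP R (x - y))) => -[k kE]; exists k.
  by rewrite -kE addrC subrK.
by rewrite kE addrAC subrr add0r.
Qed.

Lemma arc_pi (R : realType) (eps a : R) :
  arc eps (\pi_(circle R) a) = [set \pi_(circle R) t | t in `[a, a + eps]].
Proof.
have sub (b c : R) : \pi_(circle R) b = \pi_(circle R) c ->
    [set \pi_(circle R) t | t in `[b, b + eps]] `<=`
    [set \pi_(circle R) t | t in `[c, c + eps]].
  move=> /eqP/circle_eqP[k bE] y [t]; rewrite /= in_itv /= => /andP[bt tb] <-.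
  exists (t - k%:~R).
    rewrite /= in_itv /= lerBrDr -bE bt /= lerBlDr.
    by rewrite addrAC -bE.
  by apply/eqP/circle_eqP; exists (- k); rewrite mulrNz.
by rewrite eqEsubset; split; apply: sub; rewrite reprK.
Qed.

Definition subcube (R : realType) (d : nat) (eps : R) (x0 : torus R d) :
    set (torus R d) :=
  [set x | forall i : 'I_d, arc eps (x0 0 i) (x 0 i)].

Definition coverable (R : realType) (d : nat) (eps : R) (n : nat) : Prop :=
  exists F : set (set (torus R d)),
    [/\ F `<=` range (@subcube R d eps),
        (F #= `I_n)%card
      & \bigcup_(A in F) A = [set: torus R d]].

(* The default 0 is reached only when no finite family of sub-cubes covers (which
   does not happen for eps > 0): the torus is nonempty, so 0 is never a genuine
   minimum. *)
Definition mu (R : realType) (d : nat) (eps : R) : nat :=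
  xget 0%N [set n | coverable d eps n /\
                    forall m, coverable d eps m -> (n <= m)%N].

(* Main.v *)
Require Import Defs.
From HB Require Import structures.
From mathcomp Require Import all_boot all_order all_algebra.
From mathcomp Require Import all_classical all_reals.
From mathcomp Require Import zify ring lra.

Set Implicit Arguments.
Unset Strict Implicit.
Unset Printing Implicit Defensive.

Import Order.TTheory GRing.Theory Num.Theory.
Local Open Scope ring_scope.

(** The grid of r ^ 3 cubes covers because eps >= 1 / r, and the two ceilings
    are r and r ^ 2, so the content is that N = r ^ 3 - 1 cubes cannot cover.
    Write w = r ^ 2, so that r * w = N + 1.

    Averaging.  Every line parallel to an axis meets at least r cubes and every
    slice orthogonal to an axis at least w cubes: a family of cubes of side eps
    meeting each of the parallel lines of a slice at least r times has at least
    r / eps members, and r / eps > w - 1.  On a fine cyclic grid this is a double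
    count ([sum_card_ge], [slice_count]).

    Equalising the gaps.  Sort the ends b_u of the cubes along one axis, extended
    to all u by b_(u + N) = b_u + 1.  Having w cubes in every slice means
    b_(u + w) <= b_u + eps; applied r times, with r * w = N + 1, it gives
    b_(u + 1) - b_u <= r * eps - 1.  The assumption on eps says exactly that
    w - 1 such gaps are shorter than eps, and this forces
    b_(u + w + 1) > b_u + eps: each w cubes that are consecutive along the axis
    contain all the cubes of some slice.  Replacing the ends by their ranks along
    each axis therefore turns the cover into a cover of the discrete torus
    (Z / N) ^ 3 by N cubes of side w whose ends are distinct along each axis
    ([rank_compression]).

    Rigidity.  In that discrete cover most lines meet exactly r cubes.
    Move from a slice to the next: a cube p leaves and the cube q with
    x q = x p + w enters.  On a line with exactly r cubes, the r - 1 others leave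
    at least w - 1 cells uncovered, and both p and q must cover these cells; as
    their z-ends differ, z q = z p + 1 or z q = z p - 1 ([x_neighbour]).  The same
    holds for any two axes.

    Contradiction.  Apply p |-> q r times: x increases by r * w = 1 modulo N, while
    y changes by at most r ([x_walk]).  Hence cubes adjacent along x have y-ends
    at distance at most r.  But the cube whose y-end is y p + w is adjacent to p
    along x, and r < w < N - r ([no_permutation_cover]). *)

(** * Discrete covers of a cyclic grid *)

Lemma natr_small n m : (m < n.+2)%N -> nat_of_ord (m%:R : 'I_n.+2) = m.
Proof. by move=> mn; rewrite Zp_nat /= modn_small. Qed.

Lemma natr_ord_max n : n.+1%:R + 1 = 0 :> 'I_n.+2.
Proof. by rewrite natr1 Zp_nat; apply: ord_inj; rewrite /= modnn. Qed.

Lemma natr_modulus m : m.+2%:R = 0 :> 'I_m.+2.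
Proof. by rewrite -natr1 natr_ord_max. Qed.

(** A cube of side w whose last cell along an axis is u occupies the cells
    u - w + 1, ..., u of the cyclic grid; thus window w c u says that it covers
    the cell c.  Recording last cells rather than first ones makes the covering
    condition a condition on u - c only. *)
Definition window n w (c : 'I_n.+2) : pred 'I_n.+2 :=
  fun u => (nat_of_ord (u - c)%R < w)%N.

(** The cube i has last cell (x i, y i, z i). *)
Definition discrete_cover (T : finType) (n w : nat) (x y z : T -> 'I_n.+2) :=
  forall a b c, exists i, [/\ window w a (x i), window w b (y i) & window w c (z i)].

Lemma card_window n w (u : 'I_n.+2) : (w <= n.+2)%N ->
  #|[set c | window w c u]| = w.
Proof.
move=> wn; have inj : injective (fun c : 'I_n.+2 => u - c).
  by move=> c d /= /(@addrI _ u)/oppr_inj.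
rewrite -[RHS](card_ord w) -(card_imset _ inj).
have winj : injective (widen_ord wn).
  by move=> c d cd; apply/val_inj; exact: (congr1 val cd).
rewrite -(card_imset _ winj); apply: eq_card => c.
apply/imsetP/imsetP => [[d] | [d _ ->]].
  by rewrite inE => dw ->; exists (Ordinal dw) => //; apply: ord_inj.
by exists (u - widen_ord wn d); rewrite ?inE /window subKr ?(ltn_ord d).
Qed.

Lemma sum_card_window (T : finType) n w (x : T -> 'I_n.+2) (S : {set T}) :
  (w <= n.+2)%N ->
  (\sum_c #|[set i in S | window w c (x i)]| = w * #|S|)%N.
Proof.
move=> wn; rewrite mulnC -sum_nat_const.
under eq_bigr => c _.
  rewrite -sum1_card (eq_bigl (fun i => (i \in S) && window w c (x i))); last first.
    by move=> i; rewrite !inE.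
  rewrite big_mkcondr /=; over.
rewrite exchange_big /=; apply: eq_bigr => i _.
rewrite -[RHS](card_window (x i) wn) -sum1_card [RHS]big_mkcond /=.
by apply: eq_bigr => c _; rewrite inE.
Qed.

(** Averaging over the cells c of one axis: since each cube covers only w of the
    n.+2 cells, covering every cell r times takes r * n.+2 / w cubes.  It is the
    step from points to lines (r = 1) and from lines to slices. *)
Lemma sum_card_ge (T : finType) n w r (x : T -> 'I_n.+2) (S : {set T}) :
  (w <= n.+2)%N ->
  (forall c, r <= #|[set i in S | window w c (x i)]|)%N ->
  (r * n.+2 <= w * #|S|)%N.
Proof.
move=> wn h; rewrite -(sum_card_window x S wn).
have <- : (\sum_(c : 'I_n.+2) r = r * n.+2)%N by rewrite sum_nat_const card_ord mulnC.
by apply: leq_sum => c _; exact: h.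
Qed.

Lemma discrete_coverAC (T : finType) n w (x y z : T -> 'I_n.+2) :
  discrete_cover w x y z -> discrete_cover w x z y.
Proof. by move=> h a b c; have [i [? ? ?]] := h a c b; exists i. Qed.

Lemma discrete_coverCA (T : finType) n w (x y z : T -> 'I_n.+2) :
  discrete_cover w x y z -> discrete_cover w y x z.
Proof. by move=> h a b c; have [i [? ? ?]] := h b a c; exists i. Qed.

(** Two distinct arcs of length w can share w - 1 cells only by being shifted by
    one cell.  The bound w + w <= n.+3 excludes sharing them by overlapping at
    both extremities. *)
Lemma window_both n w (u v : 'I_n.+2) :
    (w + w <= n.+3)%N -> (1 < w)%N -> (w.+1 < n.+2)%N -> v != u ->
    (w.-1 <= #|[set c | window w c u & window w c v]|)%N ->
  v = u + 1 \/ u = v + 1.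
Proof.
move=> wwn w1 wn vu h.
pose d := nat_of_ord (v - u).
have dE : v - u = d%:R by rewrite natr_Zp.
have dn : (d < n.+2)%N by exact: ltn_ord.
have d0 : (0 < d)%N.
  by rewrite lt0n; apply: contra vu => /eqP d0; rewrite -subr_eq0 dE d0.
have [d1|d1] := eqVneq d 1%N; first by left; rewrite addrC -[v](subrK u) dE d1.
have [dN|dN] := eqVneq d n.+1.
  right; have : v - u + 1 = 0 by rewrite dE dN natr_ord_max.
  by move/eqP; rewrite addrAC subr_eq0 => /eqP.
exfalso.
(* Any other shift d leaves two cells u - t, u - t' of the arc of u outside the
   arc of v: the first two or the last two, according to the side. *)
have key t t' : (t < w)%N -> (t' < w)%N -> t <> t' ->
    (w <= (d + t) %% n.+2)%N -> (w <= (d + t') %% n.+2)%N -> False.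
  move=> tw t'w tt' ht ht'.
  pose B : {set 'I_n.+2} := [set u - (t%:R); u - (t'%:R)].
  have sub : [set c | window w c u & window w c v] \subset
      [set c | window w c u] :\: B.
    apply/fintype.subsetP => c; rewrite !inE => /andP[cu cv]; rewrite cu andbT.
    have aux s : (w <= (d + s) %% n.+2)%N -> c != u - (s%:R).
      move=> hs; apply/eqP => cE; move: cv; rewrite cE /window.
      rewrite opprB addrCA addrC dE -natrD Zp_nat /=; lia.
    by rewrite negb_or !aux.
  have := subset_leq_card sub; rewrite cardsD card_window; last lia.
  have -> : [set c | window w c u] :&: B = B.
    apply/finset.setIidPr/fintype.subsetP => c; rewrite !inE => /orP[]/eqP ->;
      rewrite /window subKr natr_small //; lia.
  rewrite cards2; have -> : u - t%:R != u - t'%:R.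
    apply/eqP => /addrI/oppr_inj/(congr1 (@nat_of_ord _)); rewrite !natr_small //; lia.
  move: h; lia.
have [dw|dw] := leqP d (n.+2 - w).
  by apply: (key w.-1 w.-2); rewrite ?modn_small; lia.
by apply: (key 0%N 1%N); rewrite ?modn_small; lia.
Qed.

(** * Rigidity of covers by cubes with distinct ends *)

Section Rigidity.
Variables (r n : nat).
Hypotheses (r_gt1 : (1 < r)%N) (nE : n.+3 = (r * r ^ 2)%N).
Local Notation w := (r ^ 2)%N.

Lemma square_bounds : [/\ (w + r < n.+2)%N, (r < w)%N & (w + w <= n.+3)%N].
Proof. by move: nE; rewrite !expnS expn0; split; nia. Qed.

Section Triple.
Variables (x y z : 'I_n.+2 -> 'I_n.+2).
Hypotheses (xI : injective x) (zI : injective z).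
Hypothesis cov : discrete_cover w x y z.

Let wn : (w <= n.+2)%N. Proof. by have [] := square_bounds; lia. Qed.

Definition line a b := [set i | window w a (x i) & window w b (y i)].

Lemma line_ge a b : (r <= #|line a b|)%N.
Proof.
have [_ rw _] := square_bounds.
have := @sum_card_ge _ n w 1 z (line a b) wn _.
rewrite mul1n => H; have {H} : (n.+2 <= w * #|line a b|)%N.
  apply: H => c; rewrite card_gt0; apply/finset.set0Pn.
  by have [i [xi yi zi]] := cov a b c; exists i; rewrite !inE xi yi.
move: nE; rewrite mulnC => nE' H; rewrite leqNgt; apply/negP => /(leq_mul (leqnn w)).
rewrite mulnS; lia.
Qed.

Lemma card_x_window a : (#|[set i | window w a (x i)]| <= w)%N.
Proof.
rewrite -(card_imset _ xI).
have e : #|[set u : 'I_n.+2 | window w (- u) (- a)]| = w.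
  rewrite -[RHS](@card_window n w (- a)) // -[RHS](card_imset _ (@oppr_inj _)).
  apply: eq_card => u; rewrite inE; apply/idP/imsetP => [h|[v + ->]].
    by exists (- u); rewrite ?inE ?opprK.
  by rewrite inE opprK.
rewrite -[X in (_ <= X)%N]e; apply/subset_leq_card/fintype.subsetP => _ /imsetP[i + ->].
by rewrite !inE /window opprK addrC.
Qed.

(** The w cubes of a slice have w * w incidences with its n.+2 lines, which is
    only r more than r for each line.  So at most r lines of the slice are met
    more than r times, fewer than the w lines met by p. *)
Lemma tight_line p : exists b, window w b (y p) /\ (#|line (x p) b| <= r)%N.
Proof.
have [b1 b2 _] := square_bounds.
have [/existsP[b /andP[]]|nex] :=
  boolP [exists b, window w b (y p) && (#|line (x p) b| <= r)%N].
  by exists b.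
exfalso; move: nex; rewrite negb_exists => /forallP nex.
have E := @sum_card_window _ n w y [set i | window w (x p) (x i)] wn.
have cX := card_x_window (x p).
have : (\sum_(b : 'I_n.+2) (r + window w b (y p)) <= w * w)%N.
  apply: leq_trans (leq_mul (leqnn w) cX); rewrite -E; apply: leq_sum => b _.
  have -> : [set i in [set i | window w (x p) (x i)] | window w b (y i)] = line (x p) b.
    by apply/finset.setP => i; rewrite !inE.
  have := nex b; have := line_ge (x p) b; case: (window w b (y p)) => /=; lia.
rewrite big_split /= sum_nat_const card_ord.
have -> : (\sum_(b : 'I_n.+2) window w b (y p) = w)%N.
  rewrite -[RHS](@card_window n w (y p)) // -sum1_card [RHS]big_mkcond /=.
  by apply: eq_bigr => b _; rewrite inE; case: window.
move: nE b2; nia.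
Qed.

(** Between the slices x p and x p + 1 the only change is that p leaves and q
    enters.  On a line with exactly r cubes the cubes other than p miss at least
    n.+2 - w * (r - 1) = w - 1 cells, which both p and q have to cover. *)
Lemma x_neighbour p q : x q = x p + w%:R -> z q = z p + 1 \/ z p = z q + 1.
Proof.
move=> xq; have [b1 b2 b3] := square_bounds.
have [b [yp linep]] := tight_line p.
have pq : q != p.
  apply/eqP => pq; move: xq; rewrite pq -[LHS]addr0 => /addrI /(congr1 (@nat_of_ord _)).
  rewrite natr_small /=; lia.
pose T := line (x p) b :\ p.
have pS : p \in line (x p) b by rewrite !inE yp /window subrr /=; lia.
have cT : (#|T| <= r.-1)%N by move: linep; rewrite (cardsD1 p) pS -/T; lia.
(* T consists of the r - 1 cubes met by the line in both slices. *)
have hitp c : window w c (z p) || [exists i in T, window w c (z i)].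
  have [i [xi yi zi]] := cov (x p) b c; have [<-|ip] := eqVneq i p; first by rewrite zi.
  by apply/orP; right; apply/existsP; exists i; rewrite !inE ip xi yi zi.
have hitq c : window w c (z q) || [exists i in T, window w c (z i)].
  have [i [xi yi zi]] := cov (x p + 1) b c; have [<-|iq] := eqVneq i q; first by rewrite zi.
  apply/orP; right; apply/existsP; exists i; rewrite !inE yi zi !andbT.
  move: xi; rewrite /window opprD addrA.
  pose t := nat_of_ord (x i - x p); have tE : x i - x p = t%:R by rewrite natr_Zp.
  have tn : (t < n.+2)%N by exact: ltn_ord.
  have tw : t <> w.
    move=> tw; case/eqP: iq; apply: xI; rewrite xq -tw -tE; ring.
  have [t0|t0] := posnP t.
    rewrite tE t0 sub0r -[- 1]addr0 -(natr_ord_max n) addrC addrK natr_small //; lia.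
  rewrite tE -(prednK t0) -natr1 addrK natr_small; last lia.
  move=> htw; rewrite natr1 prednK // natr_small //; apply/andP; split; last lia.
  by apply: contraTneq t0 => ip; rewrite /t ip subrr.
apply: (@window_both n w); rewrite ?(inj_eq zI) //; try lia.
have : (#|[set c | [exists i in T, window w c (z i)]]| <= w * r.-1)%N.
  apply: leq_trans (leq_mul (leqnn w) cT).
  rewrite -(sum_card_window z T wn) -sum1_card big_mkcond /=.
  apply: leq_sum => c _; rewrite inE; case: ifP => // /existsP[i /andP[iT zi]].
  by rewrite card_gt0; apply/finset.set0Pn; exists i; rewrite !inE in iT *; rewrite iT.
have : (n.+2 <= #|[set c | [exists i in T, window w c (z i)]]|
              + #|[set c | window w c (z p) & window w c (z q)]|)%N.
  rewrite -[X in (X <= _)%N](card_ord n.+2) -cardsT.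
  apply: leq_trans (leq_card_setU _ _); apply/subset_leq_card/fintype.subsetP => c _.
  rewrite !inE; have := hitp c; have := hitq c.
  by case: [exists i in T, _]; rewrite ?orbF // => -> ->.
move: nE; nia.
Qed.

End Triple.

(** With s steps of z upwards and t - s downwards, the displacement is 2 s - t;
    it is written without subtraction. *)
Lemma x_walk (x y z : 'I_n.+2 -> 'I_n.+2) t p :
    injective x -> injective z -> discrete_cover w x y z ->
  exists q s, [/\ (s <= t)%N, x q = x p + (t * w)%:R
                & z q + t%:R = z p + (2 * s)%:R :> 'I_n.+2].
Proof.
move=> xI zI cov; elim: t => [|t [q [s [st xq zq]]]].
  by exists p, 0%N; rewrite muln0 mul0n !addr0.
have [x' _ xK] := injF_bij xI.
pose q' := x' (x q + w%:R); have xq' : x q' = x q + w%:R by rewrite xK.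
have xE : x q' = x p + (t.+1 * w)%:R by rewrite xq' xq mulSn natrD; ring.
case: (x_neighbour xI zI cov xq') => zq'; [exists q', s.+1|exists q', s]; split=> //; try lia.
  by rewrite zq' -natr1 mulnS natrD addrACA zq; ring.
by rewrite -zq -natr1 zq'; ring.
Qed.

(** The displacement of y between two cubes adjacent along x is at most r in
    absolute value by [x_walk] with t = r, but it is w for the cubes p and q
    below, which are adjacent by [x_neighbour] with the axes y and x. *)
Lemma no_permutation_cover (x y z : 'I_n.+2 -> 'I_n.+2) :
    injective x -> injective y -> injective z ->
  ~ discrete_cover w x y z.
Proof.
move=> xI yI zI cov; have [b1 b2 _] := square_bounds.
have covxzy := discrete_coverAC cov.
have covyzx := discrete_coverAC (discrete_coverCA cov).
have w1 : (r * w)%:R = 1 :> 'I_n.+2 by rewrite -nE -natr1 -natr1 natr_ord_max add0r.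
have [y' _ yK] := injF_bij yI.
pose p : 'I_n.+2 := ord0; pose q := y' (y p + w%:R).
have yq : y q = y p + w%:R by rewrite yK.
suff [s sr /addrI E] : exists2 s, (s <= r)%N & y p + (w + r)%:R = y p + (2 * s)%:R.
  by move/(congr1 (@nat_of_ord _)): E; rewrite !natr_small; lia.
case: (x_neighbour yI xI covyzx yq) => xq.
  have [q' [s [sr xq' yq']]] := x_walk r p xI yI covxzy.
  have qq' : q' = q by apply: xI; rewrite xq' xq w1.
  by exists s; rewrite // -yq' qq' yq natrD addrA.
have [q' [s [sr xq' yq']]] := x_walk r q xI yI covxzy.
have qq' : q' = p by apply: xI; rewrite xq' xq w1.
(* Here the walk leads from q back to p, so its displacement is reversed. *)
exists (r - s)%N; first lia.
have : y p + (w + r)%:R + (2 * s)%:R = y p + (2 * (r - s))%:R + (2 * s)%:R.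
  rewrite qq' yq in yq'; rewrite -[RHS]addrA -[in RHS]natrD.
  have -> : (2 * (r - s) + 2 * s = r + r)%N by lia.
  rewrite (natrD _ r r) [RHS]addrA yq' (natrD _ w r) addrA [RHS]addrAC.
  by congr (_ + _); rewrite addrAC.
by move/addIr.
Qed.

(** * From arbitrary ends to equally spaced ends *)

Section RankCompression.
Variables (m k : nat) (x : 'I_n.+2 -> 'I_m.+2).
Hypothesis km : (k <= m.+2)%N.
Hypothesis kr : (k * (r ^ 3 - r - 1) < m.+2 * (r ^ 2 - 1))%N.
Hypothesis xw : forall j, (w <= #|[set i | window k j (x i)]|)%N.

Let e := sort (relpre x (fun i j : 'I_m.+2 => (i <= j)%N)) (enum 'I_n.+2).

Let size_e : size e = n.+2. Proof. by rewrite size_sort size_enum_ord. Qed.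

Let mem_e i : i \in e. Proof. by rewrite mem_sort mem_enum. Qed.

Definition rank i : 'I_n.+2 := inord (index i e).

Lemma nth_rank i : nth ord0 e (rank i) = i.
Proof.
have := index_mem i e; rewrite mem_e size_e => ie.
by rewrite /rank inordK ?nth_index.
Qed.

Lemma rank_inj : injective rank.
Proof. by move=> i j ij; rewrite -(nth_rank i) ij nth_rank. Qed.

(** The sorted ends along one axis, unrolled to a nondecreasing sequence on nat:
    the index u turns around the n.+2 cubes while the value turns around the
    m.+2 cells. *)
Definition lift_end u := (x (nth ord0 e (u %% n.+2)) + m.+2 * (u %/ n.+2))%N.

Lemma lift_endD u t : lift_end (u + t * n.+2) = (lift_end u + t * m.+2)%N.
Proof. by rewrite /lift_end (addnC u) modnMDl divnMDl // mulnDr (mulnC m.+2 t) addnCA addnC. Qed.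

Lemma lift_endS u : (lift_end u <= lift_end u.+1)%N.
Proof.
have srt : sorted (relpre x (fun i j : 'I_m.+2 => (i <= j)%N)) e.
  by apply: sort_sorted => i j; exact: leq_total.
rewrite (divn_eq u n.+2) addnC -addSn !lift_endD leq_add2r.
have un := ltn_pmod u (ltn0Sn n.+1); move: (u %% _)%N un => v vn.
have [vn1|vn1] := ltnP v.+1 n.+2; rewrite /lift_end.
  rewrite !modn_small // !divn_small // leq_add2r.
  by apply: (sortedP ord0 srt); rewrite size_e.
have -> : v.+1 = n.+2 by lia.
rewrite modnn divnn modn_small // divn_small //=.
by have := ltn_ord (x (nth ord0 e v)); lia.
Qed.

Lemma lift_end_le : {homo lift_end : u v / (u <= v)%N}.
Proof. by apply: homo_leq => //; [exact: leq_trans|exact: lift_endS]. Qed.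

(** The cubes covering the cell just after lift_end u are those whose unrolled
    ends lie in the k cells that follow lift_end u. *)
Lemma window_lift i u : window k ((lift_end u).+1)%:R (x i) ->
  exists2 v, (v %% n.+2)%N = rank i & (lift_end u < lift_end v <= lift_end u + k)%N.
Proof.
rewrite /window; set t := nat_of_ord _ => tk.
have xE : x i = (lift_end u + t.+1)%:R.
  apply: (addIr (- ((lift_end u).+1)%:R)); rewrite -[LHS]natr_Zp -/t -natrB; last lia.
  by congr _%:R; lia.
exists (rank i + (lift_end u + t.+1) %/ m.+2 * n.+2)%N.
  by rewrite addnC modnMDl modn_small.
have -> : lift_end (rank i + (lift_end u + t.+1) %/ m.+2 * n.+2) = (lift_end u + t.+1)%N.
  rewrite lift_endD [RHS](divn_eq _ m.+2) addnC; congr addn.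
  by rewrite /lift_end modn_small // divn_small // nth_rank muln0 addn0 xE Zp_nat.
by lia.
Qed.

(** Otherwise the cell just after lift_end u would be covered only by cubes of
    indices strictly between u and u + w, which are fewer than w. *)
Lemma lift_end_window u : (lift_end (u + w) <= lift_end u + k)%N.
Proof.
have [_ rw _] := square_bounds.
rewrite leqNgt; apply/negP => lt.
have := xw ((lift_end u).+1)%:R; apply/negP; rewrite -ltnNge.
pose s := [seq inord ((u + t.+1) %% n.+2) : 'I_n.+2 | t <- iota 0 w.-1].
have : (#|[set i | window k ((lift_end u).+1)%:R (x i)]| <= size s)%N.
  rewrite -(card_imset _ rank_inj); apply: leq_trans (card_size s).
  apply/subset_leq_card/fintype.subsetP => _ /imsetP[i + ->].
  rewrite inE => /window_lift[v vi /andP[uv vu]]; apply/mapP.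
  have uv' : (u < v)%N by rewrite ltnNge; apply: contraL uv => /lift_end_le; lia.
  have vw' : (v < u + w)%N by rewrite ltnNge; apply: contraL vu => /lift_end_le; lia.
  exists (v - u.+1)%N; first by rewrite mem_iota; lia.
  have -> : (u + (v - u.+1).+1)%N = v by lia.
  by apply: ord_inj; rewrite vi inord_val.
rewrite size_map size_iota; lia.
Qed.

Lemma lift_end_windows u t : (lift_end (u + t * w) <= lift_end u + t * k)%N.
Proof.
elim: t => [|t IH]; first by rewrite !addn0.
rewrite !mulSn (addnC w) (addnC k) !addnA.
by apply: leq_trans (lift_end_window _) _; rewrite leq_add2r.
Qed.

(** As r * w = n.+2 + 1, r windows make one full turn and one more index, so that
    consecutive ends are at most r * k - m.+2 cells apart. *)
Lemma lift_end_step u t : (lift_end (u + t) + t * m.+2 <= lift_end u + t * (r * k))%N.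
Proof.
elim: t => [|t IH]; first by rewrite !addn0.
have := lift_end_windows (u + t) r.
have -> : (u + t + r * w = u + t.+1 + 1 * n.+2)%N by rewrite -nE; lia.
rewrite lift_endD mul1n !mulSn; lia.
Qed.

(** If w + 1 indices fitted in k cells, the rest of the turn would consist of
    r - 2 windows and w - 2 single gaps, and a full turn would be at most
    k + (r - 2) * k + (w - 2) * (r * k - m.+2) cells long.  The hypothesis kr is
    precisely the negation of m.+2 being at most this quantity. *)
Lemma lift_end_gap u : (lift_end u + k < lift_end (u + w).+1)%N.
Proof.
have [b1 b2 b3] := square_bounds.
rewrite ltnNge; apply/negP => lt.
have h1 := lift_end_windows (u + w).+1 (r - 2).
have h2 := lift_end_step ((u + w).+1 + (r - 2) * w) (w - 2).
have E : ((u + w).+1 + (r - 2) * w + (w - 2) = u + 1 * n.+2)%N.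
  have : (r * w = (r - 2) * w + 2 * w)%N by rewrite -mulnDl subnK.
  move: nE; lia.
rewrite E lift_endD in h2.
have r2k : (r * k = (r - 2) * k + 2 * k)%N by rewrite -mulnDl subnK.
have w2m : (w * m.+2 = (w - 2) * m.+2 + 2 * m.+2)%N by rewrite -mulnDl subnK //; lia.
have w2k : (w * (r * k) = (w - 2) * (r * k) + 2 * (r * k))%N by rewrite -mulnDl subnK //; lia.
have kE : (w * (r * k) = k * r ^ 3)%N by rewrite mulnA -expnSr mulnC.
move: kr; rewrite !mulnBr !muln1 (mulnC m.+2) (mulnC k r); lia.
Qed.

(** The cell just after lift_end u, with u the index preceding a, is covered
    only by cubes of indices in [u + 1, u + w], by [lift_end_gap]. *)
Lemma rank_compression a : exists j, forall i, window k j (x i) -> window w a (rank i).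
Proof.
(* a + n.+1 is a - 1 modulo n.+2. *)
pose u := (a + n.+1)%N; exists ((lift_end u).+1)%:R => i /window_lift[v vi /andP[uv vu]].
have uv' : (u < v)%N by rewrite ltnNge; apply: contraL uv => /lift_end_le; lia.
have vw : (v <= u + w)%N.
  by rewrite leqNgt; apply: contraL vu => /lift_end_le; have := lift_end_gap u; lia.
have rE : rank i = v%:R by apply: ord_inj; rewrite Zp_nat /= vi.
pose t := (v - u.+1)%N.
have vE : v = (t + (a + (n.+1 + 1)))%N by rewrite /t /u; rewrite /u in uv'; lia.
have [b1 _ _] := square_bounds.
have tw : (t < w)%N by rewrite /t; lia.
have {}rE : rank i = t%:R + a.
  rewrite rE vE natrD (natrD _ a) (natrD _ n.+1 1) natr_ord_max addr0.
  by congr (_ + _); exact: natr_Zp.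
by rewrite /window rE addrK natr_small //; lia.
Qed.

End RankCompression.

(** Two averagings: m.+2 / k > r - 1 / (r ^ 2 - 1) gives at least r cubes on each
    line, and then r * m.+2 / k > r ^ 2 - 1 gives at least r ^ 2 on each slice. *)
Lemma slice_count (T : finType) m k (x y z : T -> 'I_m.+2) :
  (k <= m.+2)%N -> (k * (r ^ 3 - r - 1) < m.+2 * (r ^ 2 - 1))%N ->
  discrete_cover k x y z -> forall j, (w <= #|[set i | window k j (x i)]|)%N.
Proof.
move=> km kr cov a.
have [_ rw _] := square_bounds.
have rB : ((r - 1) * (r ^ 2 - 1) <= r ^ 3 - r - 1)%N.
  by rewrite mulnBl mulnBr mul1n muln1 -expnS; lia.
have BB : ((r ^ 2 - 1) * (r ^ 2 - 1) <= r * (r ^ 3 - r - 1))%N.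
  by rewrite mulnBl mulnBr mul1n !muln1 !mulnBr muln1 -expnS -expnD -[(r * r)%N]/(r ^ 2)%N; lia.
have line_cubes b : (r <= #|[set i in [set i | window k a (x i)] | window k b (y i)]|)%N.
  have H := @sum_card_ge T m k 1 z
     [set i in [set i | window k a (x i)] | window k b (y i)] km _.
  rewrite leqNgt; apply/negP => lt; move: kr; rewrite ltnNge => /negP; apply.
  apply: leq_trans (leq_mul (leqnn k) rB); rewrite mulnA leq_mul2r.
  apply/orP; right; rewrite -[m.+2]mul1n; apply: leq_trans (H _) _.
    move=> c; rewrite card_gt0; apply/finset.set0Pn.
    by have [i [xi yi zi]] := cov a b c; exists i; rewrite !inE xi yi zi.
  by rewrite leq_mul2l; lia.
have H := @sum_card_ge T m k r y [set i | window k a (x i)] km line_cubes.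
rewrite leqNgt; apply/negP => lt; move: kr.
rewrite -(ltn_pmul2l (ltnW r_gt1)) ltnNge => /negP; apply.
rewrite mulnA mulnCA; apply: leq_trans (leq_mul (leqnn k) BB).
rewrite mulnA leq_mul2r; apply/orP; right; apply: leq_trans H _.
by rewrite leq_mul2l; lia.
Qed.

Lemma no_discrete_cover m k (x y z : 'I_n.+2 -> 'I_m.+2) :
  (k <= m.+2)%N -> (k * (r ^ 3 - r - 1) < m.+2 * (r ^ 2 - 1))%N ->
  ~ discrete_cover k x y z.
Proof.
move=> km kr cov.
have hx := slice_count km kr cov.
have hy := slice_count km kr (discrete_coverCA cov).
have hz := slice_count km kr (discrete_coverCA (discrete_coverAC cov)).
apply: (@no_permutation_cover (rank x) (rank y) (rank z)); try exact: rank_inj.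
move=> a b c.
have [ja ha] := rank_compression km kr hx a.
have [jb hb] := rank_compression km kr hy b.
have [jc hc] := rank_compression km kr hz c.
by have [i [/ha ? /hb ? /hc ?]] := cov ja jb jc; exists i.
Qed.

End Rigidity.

(** * From the real torus to the grid *)

Lemma coverable_starts (R : realType) d (eps : R) N : coverable d eps N ->
  exists g : nat -> torus R d, forall x, exists2 i, (i < N)%N & subcube eps (g i) x.
Proof.
move=> [F [FR /card_esym/card_set_bijP[f [_ _ fsurj]] Fcov]].
have /choice[g gP] i : exists x0, (i < N)%N -> f i \in F -> subcube eps x0 = f i.
  have [fF|fF] := boolP (f i \in F); last by exists (\row_j 0).
  by have [x0 _ <-] := FR _ (set_mem fF); exists x0.
exists g => x; have : (\bigcup_(A in F) A)%classic x by rewrite Fcov.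
move=> [A FA Ax]; have [i iN fi] := fsurj _ FA.
by exists i => //; rewrite gP ?fi // inE.
Qed.

(** Sample the circle at the points a / m.+2: an arc [s, s + eps] meets the sample
    in at most truncn (m.+2 * eps) + 1 consecutive points, the last of which is
    floor (m.+2 * (s + eps)), so these points form a discrete arc of that
    length. *)
Lemma window_arc (R : realType) (eps s : R) m (a : 'I_m.+2) (q : int) :
    s <= a%:R / m.+2%:R + q%:~R <= s + eps ->
  window (Num.truncn (m.+2%:R * eps)).+1 a (Num.floor (m.+2%:R * (s + eps)))%:~R.
Proof.
set E := Num.floor _ => /andP[sa as_].
have M0 : 0 < m.+2%:R :> R by rewrite ltr0n.
pose z := E - (a%:Z + q * m.+2%:Z).
have aE : (a%:Z + q * m.+2%:Z)%:~R = m.+2%:R * (a%:R / m.+2%:R + q%:~R) :> R.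
  by rewrite rmorphD rmorphM /= -!pmulrn; field; rewrite -natrD pnatr_eq0.
have z0 : 0 <= z by rewrite subr_ge0 floor_ge_int aE ler_pM2l.
have zk : z%:~R <= m.+2%:R * eps.
  rewrite rmorphB /= aE lerBlDr; apply: le_trans (floor_le _) _.
  by rewrite -mulrDr ler_pM2l // [eps + _]addrC lerD2r.
have [t zt] : exists t : nat, z = t by exists `|z|%N; rewrite gez0_abs.
have tk : (t <= Num.truncn (m.+2%:R * eps)%R)%N.
  move: zk; rewrite zt -pmulrn => zk.
  by rewrite truncn_ge_nat //; apply: le_trans zk; rewrite ler0n.
have -> : E%:~R = t%:R + a :> 'I_m.+2.
  have -> : E = z + (a%:Z + q * m.+2%:Z) by rewrite subrK.
  rewrite zt !rmorphD rmorphM /= [X in q%:~R * X]natr_modulus mulr0 addr0.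
  by congr (_ + _); exact: natr_Zp.
by rewrite /window addrK Zp_nat /= ltnS; apply: leq_trans (leq_mod _ _) tk.
Qed.

(** The rounding in [window_arc] costs at most one cell, and the inequality is
    strict, so it survives on a sufficiently fine grid. *)
Lemma fine_grid (R : realType) (eps : R) (A B : nat) : 0 <= eps -> eps * A%:R < B%:R ->
  exists m, ((Num.truncn (m.+2%:R * eps)).+1 * A < m.+2 * B)%N.
Proof.
move=> e0 AB; have d0 : 0 < B%:R - eps * A%:R by rewrite subr_gt0.
pose m := Num.truncn (A%:R / (B%:R - eps * A%:R)); exists m.
have mP : A%:R / (B%:R - eps * A%:R) < m.+2%:R.
  by apply: lt_trans (truncnS_gt _) _; rewrite ltr_nat.
rewrite -(ltr_nat R) !natrM -natr1.
rewrite ltr_pdivrMr // in mP.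
have tP : (Num.truncn (m.+2%:R * eps))%:R <= m.+2%:R * eps.
  by rewrite truncn_le // mulr_ge0 // ler0n.
have := ler_wpM2r (ler0n R A) tP; lra.
Qed.

(** The assumption on eps is eps < 1 / (r - 1 / (r ^ 2 - 1)) with denominators
    cleared. *)
Lemma coverable_ge (R : realType) (r : nat) (eps : R) N : (1 < r)%N -> 0 <= eps ->
  eps * (r ^ 3 - r - 1)%:R < (r ^ 2 - 1)%:R -> coverable 3 eps N -> (r ^ 3 <= N)%N.
Proof.
move=> r1 e0 eAB /coverable_starts[g gP]; rewrite leqNgt; apply/negP => Nr.
have r3 : (8 <= r ^ 3)%N by rewrite -(@leq_exp2r 2 r 3) in r1 *; lia.
have [n nE] : exists n, n.+3 = (r * r ^ 2)%N by exists (r ^ 3 - 3)%N; rewrite -expnS; lia.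
have [m mP] := fine_grid e0 eAB; set k := (Num.truncn _).+1 in mP.
have BA : (r ^ 2 - 1 <= r ^ 3 - r - 1)%N.
  have : (2 * r ^ 2 <= r ^ 3)%N by rewrite expnS leq_mul2r r1 orbT.
  have : (2 * r <= r ^ 2)%N by rewrite -mulnn leq_mul2r r1 orbT.
  lia.
have km : (k <= m.+2)%N.
  have : (k * (r ^ 2 - 1) < m.+2 * (r ^ 2 - 1))%N.
    by apply: leq_ltn_trans mP; rewrite leq_mul2l BA orbT.
  by rewrite ltn_mul2r => /andP[_ /ltnW].
pose x (c : 'I_3) (i : 'I_n.+2) : 'I_m.+2 :=
  (Num.floor (m.+2%:R * (repr (g i 0 c) + eps)))%:~R.
apply: (@no_discrete_cover r n r1 nE m k (x 0) (x 1) (x 2%:R) km mP) => a b c.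
pose u (j : 'I_3) := if j == 0 then a else if j == 1 then b else c.
pose p : torus R 3 := \row_j (\pi_(circle R) ((u j)%:R / m.+2%:R : R))%qT.
have [i iN ip] := gP p.
have hit j : window k (u j) (x j (inord i)).
  have := ip j; rewrite /arc mxE /= => -[t /=]; rewrite in_itv /= => tI.
  move=> /eqP/circle_eqP[q tE]; rewrite tE in tI.
  rewrite /x inordK; first exact: window_arc tI.
  by move: nE; rewrite -expnS; lia.
by exists (inord i); split; [have := hit 0|have := hit 1|have := hit 2%:R].
Qed.

(** The translates by multiples of 1 / r along each axis cover.  Only an upper
    bound on their number is claimed, which spares proving that they are distinct
    as sets. *)
Lemma coverable_grid (R : realType) d (eps : R) r : (0 < r)%N -> 1 <= eps * r%:R ->
  exists2 N, (N <= r ^ d)%N & coverable d eps N.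
Proof.
move=> r0 er; have r0R : 0 < r%:R :> R by rewrite ltr0n.
pose c (f : {ffun 'I_d -> 'I_r}) : torus R d :=
  \row_j (\pi_(circle R) ((f j)%:R / r%:R : R))%qT.
pose F := [set subcube eps (c (enum_val i)) | i in [set: 'I_#|{ffun 'I_d -> 'I_r}|]]%classic.
have finF : finite_set F by exact: finite_image.
have [N FN] := finF; exists N.
  have : (F #<= `I_(r ^ d))%card.
    apply: card_le_trans (card_image_le _ _) _.
    by rewrite -(card_le_eql card_II) card_le_II card_ffun !card_ord.
  by rewrite (card_le_eql FN) card_le_II.
exists F; split=> //; first by move=> _ [i _ <-]; exists (c (enum_val i)).
apply/seteqP; split=> // x _.
(* h j is the representative of x 0 j in [0, 1). *)
pose h (j : 'I_d) : R := repr (x 0 j) - (Num.floor (repr (x 0 j)))%:~R.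
have h0 j : 0 <= h j < 1.
  by have := floor_itv (repr (x 0 j)); rewrite intrD /h; lra.
have hr j : (Num.truncn (h j * r%:R)%R < r)%N.
  have /andP[hj0 hj1] := h0 j.
  by rewrite truncn_lt_nat ?mulr_ge0 ?ler0n //; nra.
pose f := [ffun j => Ordinal (hr j)].
exists (subcube eps (c f)); first by exists (enum_rank f) => //; rewrite enum_rankK.
move=> j; rewrite mxE arc_pi; exists (h j) => /=.
  have /andP[hj0 hj1] := h0 j.
  have /truncn_itv/andP[] : 0 <= h j * r%:R by rewrite mulr_ge0 ?ler0n.
  rewrite in_itv /= ffunE /= -natr1 ler_pdivrMr // => -> lt /=.
  by rewrite -lerBlDr ler_pdivlMr //; move: (h j) lt => y lt; lra.
rewrite -[RHS]reprK; apply/eqP/circle_eqP.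
by exists (- Num.floor (repr (x 0 j))); rewrite rmorphN.
Qed.

Theorem theorem2 (R : realType) (r : nat) (eps : R) (hr : (2 <= r)%N)
    (heps : 1 / r%:R <= eps < 1 / (r%:R - 1 / (r%:R ^+ 2 - 1))) :
  (mu 3 eps)%:Z = Num.ceil (1 / eps * (Num.ceil (1 / eps))%:~R)
                  * Num.ceil (1 / eps)
  /\ mu 3 eps = (r ^ 3)%N.
Proof.
have r2 : 2 <= r%:R :> R by rewrite ler_nat.
have B0 : 0 < r%:R ^+ 2 - 1 :> R by nra.
have A0 : 0 < r%:R ^+ 3 - r%:R - 1 :> R by nra.
have rAB : r%:R - 1 / (r%:R ^+ 2 - 1) = (r%:R ^+ 3 - r%:R - 1) / (r%:R ^+ 2 - 1) :> R.
  by field; rewrite gt_eqF.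
move: heps => /andP[er]; rewrite rAB div1r invf_div ltr_pdivlMr // => eAB.
have r0 : 0 < r%:R :> R by lra.
rewrite ler_pdivrMr // in er.
have e0 : 0 < eps by nra.
have Bn : (r ^ 2 - 1)%:R = r%:R ^+ 2 - 1 :> R by rewrite natrB ?natrX // expn_gt0; lia.
have An : (r ^ 3 - r - 1)%:R = r%:R ^+ 3 - r%:R - 1 :> R.
  have : (2 * r <= r ^ 2)%N by rewrite -mulnn leq_mul2r hr orbT.
  have : (2 * r ^ 2 <= r ^ 3)%N by rewrite expnS leq_mul2r hr orbT.
  by move=> h1 h2; rewrite !natrB ?natrX //; lia.
have lower N : coverable 3 eps N -> (r ^ 3 <= N)%N.
  by apply: coverable_ge; rewrite ?An ?Bn // ltW.
have [N Nr covN] := coverable_grid 3 (ltnW hr) er.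
have NE : N = (r ^ 3)%N by apply/eqP; rewrite eqn_leq Nr lower.
have muE : mu 3 eps = (r ^ 3)%N.
  rewrite /mu; apply: xget_unique => /=.
    by split; [rewrite -NE|exact: lower].
  by move=> M [covM minM]; apply/eqP; rewrite eqn_leq lower // -NE minM.
have ceil1 : Num.ceil (1 / eps) = r.
  apply: ceil_def; rewrite rmorphB /= -pmulrn ltr_pdivlMr // ler_pdivrMr //.
  by apply/andP; split; nra.
have ceil2 : Num.ceil (1 / eps * r%:R) = (r ^ 2)%N.
  apply: ceil_def; rewrite rmorphB /= -pmulrn natrX mulrAC mul1r.
  by rewrite ltr_pdivlMr // ler_pdivrMr //; apply/andP; split; nra.
split=> //; rewrite muE ceil1 -pmulrn ceil2.
by rewrite -PoszM -expnSr.
Qed.
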